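(* Let $D\subseteq\mathbb{R}$ be a nonempty open interval and let $\varphi:D^+\to\mathbb{R}_+$ be increasingly subadditive. Then a function $f:D\to\mathbb{R}$ is $\varphi$-convex if and only if there exist two functions $a:D\to\mathbb{R}$ and $b:D\to\mathbb{R}$ such that $$f(x)=\sup_{u\in D}\big(a(u)x+b(u)-\varphi(|x-u|)\big)$$ for all $x\in D$.
   Context: $\mathbb{R}_+$ denotes the set of nonnegative reals. $D^+:=\{|x-y|:x,y\in D\}$. The function $\varphi$ is called increasingly subadditive on $D^+$ if $\varphi(u)\leq\varphi(v)+\varphi(w)$ for all $u,v,w\in D^+$ with $u\leq v+w$. A function $f:D\to\mathbb{R}$ is called $\varphi$-convex on $D$ if $$f(tx+(1-t)y)\leq tf(x)+(1-t)f(y)+t\varphi\big((1-t)|x-y|\big)+(1-t)\varphi\big(t|x-y|\big)$$ for all $t\in[0,1]$ and all $x,y\in D$.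
   Formalization: The formal statement adds the hypothesis φ(0)=0; without it the claim is false (D=ℝ, φ≡1, f(0)=1/2 and f=0 elsewhere is φ-convex, but the supremum is always a convex function). *)

(* Defs.v *)
From mathcomp Require Import all_boot all_order all_algebra.
From mathcomp Require Import all_classical all_reals all_analysis.
Set Implicit Arguments.
Unset Strict Implicit.
Unset Printing Implicit Defensive.
Import Order.TTheory GRing.Theory Num.Theory.
Import numFieldNormedType.Exports.
Local Open Scope classical_set_scope.
Local Open Scope ring_scope.

(* Functions on a subset of R (f, a, b on D and phi on D^+) are represented by
   total functions R -> R; only their values on that subset are ever used. *)

Definition dist_set (R : realType) (D : set R) : set R :=
  [set `|x - y| | x in D & y in D].

Definition increasingly_subadditive (R : realType) (E : set R) (phi : R -> R)
    : Prop :=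
  forall u v w : R, E u -> E v -> E w -> u <= v + w -> phi u <= phi v + phi w.

(* When D is an interval, the arguments of phi below lie in [dist_set D]. *)
Definition phi_convex (R : realType) (D : set R) (phi f : R -> R) : Prop :=
  forall t x y : R, 0 <= t <= 1 -> D x -> D y ->
    f (t * x + (1 - t) * y) <=
      t * f x + (1 - t) * f y
      + t * phi ((1 - t) * `|x - y|) + (1 - t) * phi (t * `|x - y|).

(* Main.v *)
Require Import Defs.
From mathcomp Require Import all_boot all_order all_algebra.
From mathcomp Require Import all_classical all_reals all_analysis.
From mathcomp Require Import ring lra.
Import Order.TTheory GRing.Theory Num.Theory.
Import numFieldNormedType.Exports.
Local Open Scope classical_set_scope.
Local Open Scope ring_scope.

(** The functions [x |-> a u * x + b u - phi `|x - u|] are the building blocks.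

    Each of them is [phi]-convex: the affine part contributes an equality, and
    when [z = t x + (1 - t) y] the distances [`|x - z|] and [`|y - z|] are
    [(1 - t) `|x - y|] and [t `|x - y|], so the triangle inequality through [z]
    and increasing subadditivity bound [phi `|x - u|] and [phi `|y - u|] by
    [phi `|z - u|] plus exactly the error terms of [phi]-convexity.  The
    inequality passes to suprema ([sup_phi_convex]).

    Conversely, a [phi]-convex [f] has at every [u] in [D] a minorant of this
    form whose affine part equals [f u] at [u] ([phi_support]); as [phi 0 = 0],
    the minorant itself touches [f] at [u], so the supremum at [x] is attained
    by the support at [u = x].  The support comes from the classical supporting
    line argument: for [x < u < y], [phi]-convexity says that the slope of the
    chord from [x] to [u], lowered by [phi (u - x) / (u - x)], is at most the
    slope of the chord from [u] to [y], raised by [phi (y - u) / (y - u)]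
    ([phi_convex_slope_le]).  Any number separating the lowered left slopes from
    the raised right slopes is the slope of a support, and such a number exists
    because [D], being open, has points on both sides of [u]. *)

Lemma sup_phi_convex (R : realType) (D : set R) (phi f a b : R -> R) :
  is_interval D -> increasingly_subadditive (dist_set D) phi ->
  (forall x, D x ->
    (f x)%:E = ereal_sup [set (a u * x + b u - phi `|x - u|)%:E | u in D]) ->
  phi_convex D phi f.
Proof.
move=> D_itv phi_sub fE t x y /andP[t0 t1] Dx Dy.
set z := t * x + (1 - t) * y.
have Dz : D z.
  have [xy|/ltW yx] := leP x y.
    by apply: (D_itv x y Dx Dy); rewrite /z; apply/andP; split; nra.
  by apply: (D_itv y x Dy Dx); rewrite /z; apply/andP; split; nra.
have le_f v u : D v -> D u -> a u * v + b u - phi `|v - u| <= f v.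
  move=> Dv Du; rewrite -lee_fin (fE _ Dv); apply: ereal_sup_ubound.
  by exists u.
have phi_tri v u : D v -> D u -> phi `|v - u| <= phi `|v - z| + phi `|z - u|.
  move=> Dv Du; apply: phi_sub; [by exists v => //; exists u
    | by exists v => //; exists z | by exists z => //; exists u |].
  exact: ler_distD.
have xzE : `|x - z| = (1 - t) * `|x - y|.
  rewrite (_ : x - z = (1 - t) * (x - y)); last by rewrite /z; ring.
  by rewrite normrM ger0_norm// subr_ge0.
have yzE : `|y - z| = t * `|x - y|.
  rewrite (_ : y - z = t * (y - x)); last by rewrite /z; ring.
  by rewrite normrM ger0_norm// distrC.
rewrite -lee_fin (fE _ Dz); apply: ge_ereal_sup => _ [u Du <-].
rewrite lee_fin -xzE -yzE.
have fx := ler_wpM2l t0 (le_f x u Dx Du).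
have px := ler_wpM2l t0 (phi_tri x u Dx Du).
have t1' : 0 <= 1 - t by rewrite subr_ge0.
have fy := ler_wpM2l t1' (le_f y u Dy Du).
have py := ler_wpM2l t1' (phi_tri y u Dy Du).
have -> : a u * z = t * (a u * x) + (1 - t) * (a u * y) by rewrite /z; ring.
lra.
Qed.

(** This is [phi]-convexity at [u = t x + (1 - t) y] with
    [t = (y - u) / (y - x)], for which [(1 - t) `|x - y|] and [t `|x - y|] are
    the two gaps [u - x] and [y - u]. *)
Lemma phi_convex_slope_le (R : realType) (D : set R) (phi f : R -> R)
    (x u y : R) :
  phi_convex D phi f -> D x -> D y -> x < u -> u < y ->
  (f u - f x - phi (u - x)) / (u - x) <= (f y - f u + phi (y - u)) / (y - u).
Proof.
move=> f_cvx Dx Dy xu uy.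
have ux0 : 0 < u - x by rewrite subr_gt0.
have yu0 : 0 < y - u by rewrite subr_gt0.
have yx0 : 0 < y - x by lra.
have yxN0 : y - x != 0 by rewrite gt_eqF.
pose t := (y - u) / (y - x).
have t01 : 0 <= t <= 1.
  apply/andP; split; first by apply: divr_ge0; exact: ltW.
  by rewrite /t ler_pdivrMr// mul1r; lra.
have := f_cvx t x y t01 Dx Dy.
have -> : t * x + (1 - t) * y = u by rewrite /t; field.
rewrite distrC gtr0_norm//.
have -> : (1 - t) * (y - x) = u - x by rewrite /t; field.
have -> : t * (y - x) = y - u by rewrite /t; field.
move=> /(ler_wpM2l (ltW yx0)).
have tE w : (y - x) * (t * w) = (y - u) * w by rewrite /t; field.
have sE w : (y - x) * ((1 - t) * w) = (u - x) * w by rewrite /t; field.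
rewrite !mulrDr !tE !sE => H.
rewrite ler_pdivrMr// mulrAC ler_pdivlMr//.
lra.
Qed.

(** The slope is the supremum of the lowered left slopes: it is bounded by every
    raised right slope, and it is a real number because there is a point of [D]
    on each side of [u]. *)
Lemma phi_support (R : realType) (D : set R) (phi f : R -> R) (u : R) :
  open D -> phi 0 = 0 -> phi_convex D phi f -> D u ->
  exists a, forall x, D x -> f u + a * (x - u) - phi `|x - u| <= f x.
Proof.
move=> D_open phi0 f_cvx Du.
have [l Dl lu] : exists2 l, D l & l < u.
  have : \forall l \near u^'-, D l by apply: cvg_within; exact: open_nbhs_nbhs.
  move=> Dn; near (u^'-) => l; exists l; near: l => //.
  exact: nbhs_left_lt.
have [r Dr ur] : exists2 r, D r & u < r.
  have : \forall r \near u^'+, D r by apply: cvg_within; exact: open_nbhs_nbhs.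
  move=> Dn; near (u^'+) => r; exists r; near: r => //.
  exact: nbhs_right_gt.
pose S := [set (f u - f x - phi (u - x)) / (u - x) | x in D `&` [set x | x < u]].
have S_ub y : D y -> u < y -> ubound S ((f y - f u + phi (y - u)) / (y - u)).
  by move=> Dy uy _ [x [Dx xu] <-]; exact: (@phi_convex_slope_le _ D).
exists (sup S) => x Dx; have [xu|ux|->] := ltgtP x u.
- have : (f u - f x - phi (u - x)) / (u - x) <= sup S.
    apply: ub_le_sup; last by exists x.
    by exists ((f r - f u + phi (r - u)) / (r - u)); exact: S_ub.
  rewrite ler_pdivrMr ?subr_gt0// distrC gtr0_norm ?subr_gt0//.
  lra.
- have : sup S <= (f x - f u + phi (x - u)) / (x - u).
    apply: ge_sup; last exact: S_ub.
    by exists ((f u - f l - phi (u - l)) / (u - l)), l.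
  rewrite ler_pdivlMr ?subr_gt0// gtr0_norm ?subr_gt0//.
  lra.
- by rewrite subrr normr0 phi0 mulr0 addr0 subr0.
Unshelve. all: by end_near. Qed.

Theorem theorem13 (R : realType) (D : set R) (phi : R -> R)
    (D_nonempty : D !=set0) (D_open : open D) (D_itv : is_interval D)
    (phi_ge0 : forall u : R, dist_set D u -> 0 <= phi u)
    (phi_incsub : increasingly_subadditive (dist_set D) phi)
    (phi0 : phi 0 = 0)
    (f : R -> R) :
  phi_convex D phi f <->
  exists a b : R -> R, forall x : R, D x ->
    (f x)%:E = ereal_sup [set (a u * x + b u - phi `|x - u|)%:E | u in D].
Proof.
split=> [f_cvx|[a [b fE]]]; last exact: (@sup_phi_convex _ D phi f a b).
have /choice[a aP] u : exists a, D u -> forall x, D x ->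
    f u + a * (x - u) - phi `|x - u| <= f x.
  have [Du|nDu] := pselect (D u); last by exists 0.
  by have [a aP] := @phi_support _ D phi f u D_open phi0 f_cvx Du; exists a.
exists a, (fun u => f u - a u * u) => x Dx.
apply/eqP; rewrite eq_le; apply/andP; split.
  apply: ereal_sup_ubound; exists x => //.
  by rewrite subrr normr0 phi0 subr0 addrCA subrr addr0.
apply: ge_ereal_sup => _ [u Du <-]; rewrite lee_fin.
by have := aP u Du x Dx; lra.
Qed.
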